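(* The scheme $$\mu\,\frac{{\bf H}^{n+1}-{\bf H}^n}{\tau}=-\hat{\bf D}\,\frac{{\bf E}^{n+1}+{\bf E}^n}{2},\qquad \epsilon\,\frac{{\bf E}^{n+1}-{\bf E}^n}{\tau}=\hat{\bf D}\,\frac{{\bf H}^{n+1}+{\bf H}^n}{2}$$ is unconditionally stable and non-dissipative. That is, for all $\tau>0$, all mesh sizes and all admissible wave numbers, every amplification factor $\lambda$ of the scheme satisfies $|\lambda|=1$.
   Context: Grid: $N_x,N_y,N_z$ are even positive integers, the domain is $[x_L,x_R]\times[y_L,y_R]\times[z_L,z_R]$, $L_w=w_R-w_L$, $h_w=L_w/N_w$, $\mu_w=2\pi/L_w$ for $w\in\{x,y,z\}$; $w_j=w_L+(j-1)h_w$, $j=1,\dots,N_w$. $\tau>0$ is the time step. $\epsilon,\mu>0$ are constants and $c=1/\sqrt{\epsilon\mu}$. ${\bf D}_1^w\in\mathbb R^{N_w\times N_w}$ is the Fourier spectral first-order differentiation matrix: $({\bf D}_1^w)_{j,l}=\tfrac12\mu_w(-1)^{j+l}\cot\big(\mu_w\tfrac{w_j-w_l}{2}\big)$ for $j\ne l$, and $({\bf D}_1^w)_{j,j}=0$. Put ${\bf D}_1={\bf I}_{N_z}\otimes{\bf I}_{N_y}\otimes{\bf D}_1^x$, ${\bf D}_2={\bf I}_{N_z}\otimes{\bf D}_1^y\otimes{\bf I}_{N_x}$, ${\bf D}_3={\bf D}_1^z\otimes{\bf I}_{N_y}\otimes{\bf I}_{N_x}$ ($\otimes$ the Kronecker product),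 acting on grid functions $U_{j,k,m}$ ordered as vectors with $j$ varying fastest, then $k$, then $m$. Let $${\bf D}=\begin{pmatrix}0&-{\bf D}_3&{\bf D}_2\\ {\bf D}_3&0&-{\bf D}_1\\ -{\bf D}_2&{\bf D}_1&0\end{pmatrix},\qquad \hat{\bf D}={\bf D}+\frac{c^2\tau^2}{12}{\bf D}^3+\frac{c^4\tau^4}{120}{\bf D}^5 .$$ ${\bf H}^n,{\bf E}^n$ have component blocks ordered $x,y,z$. Stability is understood in the von Neumann (Fourier) sense. Admissible wave numbers are $(\kappa_x,\kappa_y,\kappa_z)$ with $-\pi\le h_w\kappa_w\le\pi$ and $\kappa_wL_w\in2\pi\mathbb Z$ (so that $e^{-\mathrm i\kappa_wjh_w}$ is $N_w$-periodic in $j$). An amplification factor (increasing factor) for such a wave number vector is a $\lambda\in\mathbb C$ for which there is a nonzero amplitude vector $((H_x)_0,(H_y)_0,(H_z)_0,(E_x)_0,(E_y)_0,(E_z)_0)\in\mathbb C^6$ such that the plane wave $U_{w_{j,k,m}}^n=(U_w)_0\,\lambda^ne^{-\mathrm i(\kappa_xjh_x+\kappa_ykh_y+\kappa_zmh_z)}$, $U\in\{H,E\}$, $w\in\{x,y,z\}$, satisfies the scheme (equivalently, an eigenvalue of the resulting $6\times6$ amplification matrix). Unconditionally stable means that no amplification factor has modulus larger than one, with no restriction on $\tau$ relative to the mesh sizes; non-dissipative means that all amplification factors have modulus exactly one. *)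

(* Defs.v *)
From HB Require Import structures.
From mathcomp Require Import all_boot all_order all_algebra.
From mathcomp Require Import reals trigo.
From mathcomp Require Import complex mxtens.

Set Implicit Arguments.
Unset Strict Implicit.
Unset Printing Implicit Defensive.
Import Order.TTheory GRing.Theory Num.Theory.
Local Open Scope ring_scope.
Local Open Scope complex_scope.

Section Grid.
Variable R : realType.

Record axis := Axis {
  axis_l : R;
  axis_r : R;
  npts : nat;
  axis_lt : axis_l < axis_r;
  npts_gt0 : (0 < npts)%N;
  npts_even : ~~ odd npts }.

Definition len (w : axis) : R := axis_r w - axis_l w.

Definition mesh (w : axis) : R := len w / (npts w)%:R.

Definition freq (w : axis) : R := 2 * pi / len w.

(* The ordinal j : 'I_N stands for the 1-based index j + 1, so that this is
   w_L + ((j + 1) - 1) h. *)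
Definition grid_pt (w : axis) (j : 'I_(npts w)) : R :=
  axis_l w + j%:R * mesh w.

Definition cot (x : R) : R := cos x / sin x.

(* The sign is insensitive to shifting both indices by one. *)
Definition spectral_diff (w : axis) : 'M[R]_(npts w) :=
  \matrix_(j, l)
    if j == l then 0
    else 2^-1 * freq w * (-1) ^+ (j + l)
         * cot (freq w * ((grid_pt j - grid_pt l) / 2)).

Definition admissible (w : axis) (k : R) : Prop :=
  - pi <= mesh w * k <= pi /\ exists p : int, k * len w = 2 * pi * p%:~R.

Section Scheme.
Variables X Y Z : axis.
Local Notation Nx := (npts X).
Local Notation Ny := (npts Y).
Local Notation Nz := (npts Z).
Local Notation N := (Nz * Ny * Nx)%N.

Definition diff1 : 'M[R]_N := (1%:M : 'M_Nz) *t (1%:M : 'M_Ny) *t spectral_diff X.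
Definition diff2 : 'M[R]_N := (1%:M : 'M_Nz) *t spectral_diff Y *t (1%:M : 'M_Nx).
Definition diff3 : 'M[R]_N := spectral_diff Z *t (1%:M : 'M_Ny) *t (1%:M : 'M_Nx).

Definition curl_mx : 'M[R]_(N + (N + N)) :=
  col_mx (row_mx 0        (row_mx (- diff3) diff2))
 (col_mx (row_mx diff3    (row_mx 0         (- diff1)))
         (row_mx (- diff2) (row_mx diff1    0))).

Definition light_speed (eps mu : R) : R := 1 / Num.sqrt (eps * mu).

Definition curl_hat (eps mu tau : R) : 'M[R]_(N + (N + N)) :=
  let c := light_speed eps mu in
  curl_mx + (c ^+ 2 * tau ^+ 2 / 12) *: curl_mx ^+ 3
          + (c ^+ 4 * tau ^+ 4 / 120) *: curl_mx ^+ 5.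

(* The coefficients are real; they are embedded in R[i] because plane waves are
   complex-valued solutions. *)
Definition scheme (eps mu tau : R) (H E : nat -> 'cV[R[i]]_(N + (N + N))) : Prop :=
  let Dhat := map_mx (real_complex R) (curl_hat eps mu tau) in
  forall n : nat,
    mu%:C *: ((tau%:C)^-1 *: (H n.+1 - H n))
      = - (Dhat *m (2^-1 *: (E n.+1 + E n))) /\
    eps%:C *: ((tau%:C)^-1 *: (E n.+1 - E n))
      = Dhat *m (2^-1 *: (H n.+1 + H n)).

(* Vector of the grid function U j k m, with j varying fastest, then k, then m:
   mxtens_unindex decodes a Kronecker index into its (slow, fast) components. *)
Definition grid_vec (U : 'I_Nx -> 'I_Ny -> 'I_Nz -> R[i]) : 'cV[R[i]]_N :=
  \col_s let: (mk, j) := mxtens_unindex s in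
         let: (m, k) := mxtens_unindex mk in U j k m.

Definition field_vec (U : 'I_3 -> 'I_Nx -> 'I_Ny -> 'I_Nz -> R[i])
    : 'cV[R[i]]_(N + (N + N)) :=
  col_mx (grid_vec (U 0)) (col_mx (grid_vec (U 1)) (grid_vec (U 2))).

(* exp (i t) *)
Definition expi (t : R) : R[i] := cos t +i* sin t.

(* Ordinals are shifted by one because grid indices start at 1. *)
Definition plane_wave (kx ky kz : R) (lam : R[i]) (A : 'cV[R[i]]_3) (n : nat)
    : 'cV[R[i]]_(N + (N + N)) :=
  field_vec (fun w j k m => A w 0 * lam ^+ n *
    expi (- (kx * j.+1%:R * mesh X + ky * k.+1%:R * mesh Y
             + kz * m.+1%:R * mesh Z))).

Definition amplification_factor (eps mu tau kx ky kz : R) (lam : R[i]) : Prop :=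
  exists2 A : 'cV[R[i]]_(3 + 3), A != 0 &
    scheme eps mu tau (plane_wave kx ky kz lam (usubmx A))
                      (plane_wave kx ky kz lam (dsubmx A)).

End Scheme.

Definition unconditionally_stable (eps mu : R) : Prop :=
  forall (X Y Z : axis) (tau : R), 0 < tau ->
  forall kx ky kz : R, admissible X kx -> admissible Y ky -> admissible Z kz ->
  forall lam : R[i],
    amplification_factor X Y Z eps mu tau kx ky kz lam -> `|lam| <= 1.

Definition non_dissipative (eps mu : R) : Prop :=
  forall (X Y Z : axis) (tau : R), 0 < tau ->
  forall kx ky kz : R, admissible X kx -> admissible Y ky -> admissible Z kz ->
  forall lam : R[i],
    amplification_factor X Y Z eps mu tau kx ky kz lam -> `|lam| = 1.

End Grid.

(* Main.v *)
Require Import Defs.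
From HB Require Import structures.
From mathcomp Require Import all_boot all_order all_algebra.
From mathcomp Require Import reals trigo.
From mathcomp Require Import complex mxtens ring.

Import Order.TTheory GRing.Theory Num.Theory.
Local Open Scope ring_scope.

(** The spatial operator of the scheme is a real symmetric matrix. Each
    one-dimensional spectral matrix is antisymmetric because the cotangent is
    odd ([spectral_diff_tr]), the Kronecker products inherit this, and the
    antisymmetric block pattern of the curl turns it into symmetry
    ([curl_mx_tr]), which polynomials in the curl keep ([curl_hat_tr]).

    For a symmetric operator [M] the scheme is the implicit midpoint rule for
    [mu H' = - M E], [eps E' = M H], which conserves the quadratic energy
    [mu |H|^2 + eps |E|^2]. For a mode that is multiplied by [lam] in each
    step, pairing the two equations with [H] and [E] and adding them gives
    [lam (q + d) = q - d], where [q > 0] is the energy divided by the time step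
    and [d] is half the difference between the number [<M E, H>] and its
    conjugate, hence imaginary. So [lam] is a quotient of two conjugate numbers
    and has modulus one ([midpoint_factor_norm1]).

    The energy [q] has to be positive, that is, the mode must be nonzero: a
    nonzero amplitude gives a nonzero plane wave on the grid
    ([plane_wave0_eq0]). *)

(** * The implicit midpoint rule with a Hermitian operator *)

Lemma dotmx_hermitian (C : numClosedFieldType) (n : nat) (M : 'M[C]_n)
    (u v : 'rV[C]_n) :
  M \is hermsymmx -> dotmx (v *m M) u = (dotmx (u *m M) v)^*.
Proof.
move=> /is_hermitianmxP; rewrite expr0 scale1r => hM.
rewrite !dotmxE {1}hM -mulmxA -map_mxM -trmx_mul; set w := u *m M.
rewrite !mxE rmorph_sum; apply: eq_bigr => i _.
by rewrite !mxE rmorphM /= conjCK mulrC.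
Qed.

(** Numerator and denominator of the Cayley transform [(q - d) / (q + d)] of an
    imaginary number are conjugate to each other. *)
Lemma cayley_norm1 (C : numClosedFieldType) (q d lam : C) :
  0 < q -> d^* = - d -> lam * (q + d) = q - d -> `|lam| = 1.
Proof.
move=> q0 dN eqlam.
have conj_den : (q + d)^* = q - d by rewrite rmorphD /= dN geC0_conj ?ltW.
have den0 : q + d != 0.
  apply/eqP => den0; move: conj_den; rewrite den0 conjC0 => num0.
  have : q + q = 0 by rewrite -[q in q + _](addrK d) den0 add0r addrC -num0.
  by move/eqP; rewrite gt_eqF ?addr_gt0.
apply: (mulIf (x := `|q + d|)); first by rewrite normr_eq0.
by rewrite -normrM eqlam -conj_den norm_conjC mul1r.
Qed.

(** Pairing the two equations with [h] and [e] and adding them leaves the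
    energy [p |h|^2 + q |e|^2] and the imaginary part of the coupling
    [<e M, h>]; its real part cancels because the two equations couple [h] and
    [e] with opposite signs. *)
Lemma midpoint_factor_norm1 (C : numClosedFieldType) (n : nat) (M : 'M[C]_n)
    (p q lam : C) (h e : 'rV[C]_n) :
    M \is hermsymmx -> 0 < p -> 0 < q -> (h != 0) || (e != 0) ->
    p *: (lam *: h - h) = - ((2^-1 *: (lam *: e + e)) *m M) ->
    q *: (lam *: e - e) = (2^-1 *: (lam *: h + h)) *m M ->
  `|lam| = 1.
Proof.
move=> hM p0 q0 he0 /(congr1 (fun u => dotmx u h)) eqh
  /(congr1 (fun u => dotmx u e)) eqe.
pose s := dotmx (e *m M) h.
apply: (@cayley_norm1 _ (p * dotmx h h + q * dotmx e e) (2^-1 * (s - s^*))).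
- have h0 := dnorm_ge0 (@dotmx C n) h; have e0 := dnorm_ge0 (@dotmx C n) e.
  case/orP: he0; rewrite -(dnorm_gt0 (@dotmx C n)) => x0.
    by apply: ltr_wpDr; rewrite ?mulr_gt0 // mulr_ge0 // ltW.
  by apply: ltr_wpDl; rewrite ?mulr_gt0 // mulr_ge0 // ltW.
- by rewrite rmorphM rmorphB fmorphV /= conjCK conjC_nat -mulrN opprB.
move: eqh eqe; rewrite -!scalemxAl !mulmxDl -!scalemxAl.
rewrite !(linearNl, linearZl_LR, linearDl) /=.
rewrite [dotmx (h *m M) e](dotmx_hermitian _ _ _ _ _ hM) -/s.
move: (s^*) => s' eqh eqe; apply/eqP; rewrite -subr_eq0; apply/eqP.
(* The difference of the two sides is the sum of the two paired equations. *)
transitivity ((p * (lam * dotmx h h - dotmx h h) + 2^-1 * (lam * s + s))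
            + (q * (lam * dotmx e e - dotmx e e) - 2^-1 * (lam * s' + s'))).
  by ring.
by rewrite eqh eqe addNr subrr addr0.
Qed.

(** * Symmetry of the discrete curl *)

Lemma trmxX (R : comPzRingType) (n : nat) (A : 'M[R]_n) (k : nat) :
  (A ^+ k)^T = A^T ^+ k.
Proof.
elim: k => [|k IHk]; first by rewrite !expr0 trmx1.
by rewrite exprS exprSr -!mulmxE trmx_mul IHk.
Qed.

Section Symmetry.
Variable R : realType.
Implicit Types X Y Z w : axis R.

Lemma spectral_diff_tr w : (spectral_diff w)^T = - spectral_diff w.
Proof.
apply/matrixP => j l; rewrite !mxE eq_sym; case: eqP => _.
  by rewrite oppr0.
rewrite [(l + j)%N]addnC -opprB mulNr mulrN /cot cosN sinN invrN.
by rewrite !mulrN.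
Qed.

Lemma tensmxNl m n p q (A : 'M[R]_(m, n)) (B : 'M[R]_(p, q)) :
  (- A) *t B = - (A *t B).
Proof. by apply/matrixP => i j; rewrite !mxE mulNr. Qed.

Lemma tensmxNr m n p q (A : 'M[R]_(m, n)) (B : 'M[R]_(p, q)) :
  A *t (- B) = - (A *t B).
Proof. by apply/matrixP => i j; rewrite !mxE mulrN. Qed.

Lemma diff1_tr X Y Z : (diff1 X Y Z)^T = - diff1 X Y Z.
Proof. by rewrite /diff1 !trmx_tens !trmx1 spectral_diff_tr tensmxNr. Qed.

Lemma diff2_tr X Y Z : (diff2 X Y Z)^T = - diff2 X Y Z.
Proof.
by rewrite /diff2 !trmx_tens !trmx1 spectral_diff_tr tensmxNr tensmxNl.
Qed.

Lemma diff3_tr X Y Z : (diff3 X Y Z)^T = - diff3 X Y Z.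
Proof. by rewrite /diff3 !trmx_tens !trmx1 spectral_diff_tr !tensmxNl. Qed.

(** The curl is antisymmetric as a [3 x 3] array of blocks, and each block is
    antisymmetric; the two signs cancel. *)
Lemma curl_mx_tr X Y Z : (curl_mx X Y Z)^T = curl_mx X Y Z.
Proof.
rewrite /curl_mx !(tr_col_mx, tr_row_mx) !linearN /= diff1_tr diff2_tr diff3_tr.
rewrite !opprK !trmx0.
(* Turn the column of block rows into a row of block columns. *)
by do 3!rewrite -!block_mxEv !block_mxEh.
Qed.

Lemma curl_hat_tr X Y Z (eps mu tau : R) :
  (curl_hat X Y Z eps mu tau)^T = curl_hat X Y Z eps mu tau.
Proof. by rewrite /curl_hat !linearD !linearZ /= !trmxX curl_mx_tr. Qed.

Lemma curl_hat_hermsym X Y Z (eps mu tau : R) :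
  map_mx (real_complex R) (curl_hat X Y Z eps mu tau) \is hermsymmx.
Proof.
apply: realsym_hermsym.
  apply/is_hermitianmxP; rewrite expr0 scale1r map_mx_id //.
  by rewrite map_trmx curl_hat_tr.
by apply/mxOverP => i j; rewrite mxE; apply/complex_realP; eexists.
Qed.

End Symmetry.

(** * Plane waves *)

Section PlaneWave.
Variable R : realType.
Implicit Types X Y Z : axis R.

Lemma expi_neq0 (t : R) : expi t != 0.
Proof.
apply/eqP => -[c0 s0]; have := cos2Dsin2 t.
by rewrite c0 s0 !expr0n addr0 => /eqP; rewrite eq_sym oner_eq0.
Qed.

Lemma grid_vecE X Y Z U j k m :
  @grid_vec R X Y Z U (mxtens_index (mxtens_index (m, k), j)) 0 = U j k m.
Proof. by rewrite mxE !mxtens_indexK. Qed.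

(** Reading off one grid point suffices, since the phase factor never vanishes;
    the point exists because every axis has at least one grid point. *)
Lemma plane_wave0_eq0 X Y Z kx ky kz lam A :
  @plane_wave R X Y Z kx ky kz lam A 0 = 0 -> A = 0.
Proof.
pose j := Ordinal (npts_gt0 X); pose k := Ordinal (npts_gt0 Y).
pose m := Ordinal (npts_gt0 Z).
have comp0 w : @grid_vec R X Y Z (fun j k m => A w 0 * lam ^+ 0 *
    expi (- (kx * j.+1%:R * mesh X + ky * k.+1%:R * mesh Y
           + kz * m.+1%:R * mesh Z))) = 0 -> A w 0 = 0.
  move/matrixP/(_ (mxtens_index (mxtens_index (m, k), j)) 0).
  rewrite grid_vecE mxE => /eqP; rewrite !mulf_eq0 (negPf (expi_neq0 _)).
  by rewrite expr0 oner_eq0 !orbF => /eqP.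
move/eqP; rewrite !col_mx_eq0.
move=> /and3P[/eqP/comp0 a0 /eqP/comp0 a1 /eqP/comp0 a2].
apply/matrixP => i c; rewrite (ord1 c) mxE.
case: i => [[|[|[|//]]] hi].
- by rewrite -[RHS]a0; congr (A _ _); apply: val_inj.
- by rewrite -[RHS]a1; congr (A _ _); apply: val_inj.
- by rewrite -[RHS]a2; congr (A _ _); apply: val_inj.
Qed.

Lemma plane_waveS X Y Z kx ky kz lam A n :
  @plane_wave R X Y Z kx ky kz lam A n.+1 =
  lam *: plane_wave X Y Z kx ky kz lam A n.
Proof.
rewrite /plane_wave /field_vec !scale_col_mx.
have gridZ U V : (forall j k m, V j k m = lam * U j k m) ->
    @grid_vec R X Y Z V = lam *: grid_vec U.
  move=> VU; apply/matrixP => s c; rewrite !mxE.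
  by case: (mxtens_unindex s) => mk j; case: (mxtens_unindex mk) => m k.
by congr col_mx; [|congr col_mx]; apply: gridZ => j k m; rewrite exprS; ring.
Qed.

(** One time step, from [0] to [1], is enough to force the modulus. *)
Lemma amplification_factor_norm1 X Y Z (eps mu tau kx ky kz : R) lam :
    0 < eps -> 0 < mu -> 0 < tau ->
    amplification_factor X Y Z eps mu tau kx ky kz lam ->
  `|lam| = 1.
Proof.
move=> eps0 mu0 tau0 [A A0 /(_ 0) []]; rewrite !plane_waveS.
(* The Hermitian form is defined on row vectors. *)
move=> /(congr1 trmx) eqH /(congr1 trmx) eqE.
have posC (r : R) : 0 < r -> 0 < r%:C%C by rewrite ltcE /= eqxx.
have pos (r : R) : 0 < r -> 0 < r%:C%C / tau%:C%C.
  by move=> r0; rewrite divr_gt0 ?posC.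
have trZ k a (v : 'cV[complex R]_k) : (a *: v)^T = a *: v^T by exact: linearZ.
have trD k (u v : 'cV[complex R]_k) : (u + v)^T = u^T + v^T by exact: linearD.
have trN k (v : 'cV[complex R]_k) : (- v)^T = - v^T by exact: linearN.
have hM := curl_hat_hermsym _ X Y Z eps mu tau.
have hMT : (map_mx (real_complex R) (curl_hat X Y Z eps mu tau))^T =
    map_mx (real_complex R) (curl_hat X Y Z eps mu tau).
  by rewrite map_trmx curl_hat_tr.
apply: (midpoint_factor_norm1 _ _ _ (mu%:C%C / tau%:C%C) (eps%:C%C / tau%:C%C) _
  (plane_wave X Y Z kx ky kz lam (usubmx A) 0)^T
  (plane_wave X Y Z kx ky kz lam (dsubmx A) 0)^T hM (pos _ mu0) (pos _ eps0)).
- apply: contraNT A0; rewrite negb_or !negbK !trmx_eq0.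
  move=> /andP[/eqP/plane_wave0_eq0 Ah0 /eqP/plane_wave0_eq0 Ae0].
  by rewrite -[A]vsubmxK Ah0 Ae0 col_mx0.
- by move: eqH; rewrite scalerA trZ trD trN trZ trN trmx_mul hMT trZ trD trZ.
- by move: eqE; rewrite scalerA trZ trD trZ trN trmx_mul hMT trZ trD trZ.
Qed.

End PlaneWave.

Theorem theorem6p1 (R : realType) (eps mu : R) (heps : 0 < eps) (hmu : 0 < mu) :
  unconditionally_stable eps mu /\ non_dissipative eps mu.
Proof.
have norm1 : non_dissipative eps mu.
  move=> X Y Z tau tau0 kx ky kz _ _ _ lam.
  by apply: amplification_factor_norm1.
split=> // X Y Z tau tau0 kx ky kz adx ady adz lam amp.
by rewrite (norm1 X Y Z tau tau0 kx ky kz adx ady adz lam amp).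
Qed.
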